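(* Let $\Pi$ be a probability measure on $\mathsf{X}\times\mathsf{Y}\times\mathsf{Z}$, and let $\Pi^*$ and the kernels $K$, $K_Z$, $K_{XY}$, $K^\dagger$, $K^*$ be as defined in the context, where the corresponding Markov chains are assumed irreducible, aperiodic and positive Harris recurrent. Let $\|\cdot\|$ denote total variation distance. (1) Fix $z\in\mathsf{Z}$ and let $\nu_z$ denote the probability measure of the random vector $(X,Z)$ such that $Z=z$ with probability 1 and the conditional distribution of $X$ given $Z$ is $\Pi_{X|Z}(\cdot|z)$. Then for all $x\in\mathsf{X}$, $y\in\mathsf{Y}$ and all integers $n\ge 3$, $$\big\|K^n\big((x,y,z),\cdot\big)-\Pi(\cdot)\big\|\le\big\|K_Z^{n-1}(z,\cdot)-\Pi_Z(\cdot)\big\|\le\big\|\nu_zK^{*(n-2)}(\cdot)-\Pi^*(\cdot)\big\|.$$ (2) Fix $(x,z)\in\mathsf{X}\times\mathsf{Z}$ and let $\nu_{(x,z)}$ denote the probability measure of the random vector $(X,Y)$ such that $X=x$ with probability 1 and the conditional distribution of $Y$ given $X$ is $\Pi_{Y|XZ}(\cdot|x,z)$. Then for all $y\in\mathsf{Y}$ and all integers $n\ge 2$, $$\big\|K^{*n}\big((y,z,x),\cdot\big)-\Pi^*(\cdot)\big\|\le\big\|\nu_{(x,z)}K_{XY}^{n-1}(\cdot)-\Pi_{XY}(\cdot)\big\|\le\big\|\nu_{(x,z)}K^{\dagger(n-1)}(\cdot)-\Pi(\cdot)\big\|.$$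
   Context: Setting. $\mathsf{X},\mathsf{Y},\mathsf{Z}$ are measurable spaces with countably generated $\sigma$-algebras, and $\Pi(\mathrm{d}x,\mathrm{d}y,\mathrm{d}z)$ is a probability measure on $\mathsf{X}\times\mathsf{Y}\times\mathsf{Z}$, viewed as the law of a random vector $(X,Y,Z)$. Subscripts denote marginals ($\Pi_{XY}$, $\Pi_{YZ}$, $\Pi_Z$, etc.) and regular conditional distributions: $\Pi_{X|Z}(\mathrm{d}x|z)$, $\Pi_{Y|XZ}(\mathrm{d}y|x,z)$, $\Pi_{Z|XY}(\mathrm{d}z|x,y)$ are fixed Markov kernels that are versions of the respective conditional distributions under $\Pi$, and $\Pi_{XY|Z}(\mathrm{d}x,\mathrm{d}y|z)=\Pi_{X|Z}(\mathrm{d}x|z)\,\Pi_{Y|XZ}(\mathrm{d}y|x,z)$ for every $z$. Kernels. - Block Gibbs chain, on $\mathsf{X}\times\mathsf{Y}\times\mathsf{Z}$: $K\big((x,y,z),(\mathrm{d}x',\mathrm{d}y',\mathrm{d}z')\big)=\Pi_{Z|XY}(\mathrm{d}z'|x',y')\,\Pi_{XY|Z}(\mathrm{d}x',\mathrm{d}y'|z)$. - Its marginal chains: $K_{XY}\big((x,y),(\mathrm{d}x',\mathrm{d}y')\big)=\int_{\mathsf{Z}}\Pi_{XY|Z}(\mathrm{d}x',\mathrm{d}y'|z)\,\Pi_{Z|XY}(\mathrm{d}z|x,y)$ on $\mathsf{X}\times\mathsf{Y}$, and $K_Z(z,\mathrm{d}z')=\int_{\mathsf{X}}\int_{\mathsf{Y}}\Pi_{Z|XY}(\mathrm{d}z'|x,y)\,\Pi_{XY|Z}(\mathrm{d}x,\mathrm{d}y|z)$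 on $\mathsf{Z}$. - Reordered (valid) block Gibbs chain, on $\mathsf{Z}\times\mathsf{X}\times\mathsf{Y}$: $K^\dagger\big((z,x,y),(\mathrm{d}z',\mathrm{d}x',\mathrm{d}y')\big)=\Pi_{XY|Z}(\mathrm{d}x',\mathrm{d}y'|z')\,\Pi_{Z|XY}(\mathrm{d}z'|x,y)$. - Out-of-order block Gibbs chain, on $\mathsf{Y}\times\mathsf{Z}\times\mathsf{X}$: $K^*\big((y,z,x),(\mathrm{d}y',\mathrm{d}z',\mathrm{d}x')\big)=\Pi_{X|Z}(\mathrm{d}x'|z')\,\Pi_{Z|XY}(\mathrm{d}z'|x,y')\,\Pi_{Y|XZ}(\mathrm{d}y'|x,z)$. Define $\Pi^*(\mathrm{d}x,\mathrm{d}y,\mathrm{d}z)=\Pi_{X|Z}(\mathrm{d}x|z)\,\Pi_{YZ}(\mathrm{d}y,\mathrm{d}z)$; it is the invariant probability distribution of $K^*$. Measures on products of $\mathsf{X},\mathsf{Y},\mathsf{Z}$ taken in different orders are identified by permuting coordinates. Notation. $P^n$ is the $n$-step kernel of $P$, and $\mu P^n(\cdot)=\int P^n(u,\cdot)\,\mu(\mathrm{d}u)$. Since $K^*\big((y,z,x),\cdot\big)$ does not depend on $y$, for $m\ge1$ the kernel $K^{*m}$ is a function of the starting values $(x,z)$ only, and $\nu_zK^{*m}$ is the integral of $K^{*m}$ against $\nu_z(\mathrm{d}x,\mathrm{d}z)$. Likewise $K^\dagger\big((z,x,y),\cdot\big)$ does not depend on $z$, so for $m\ge1$, $\nu_{(x,z)}K^{\dagger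 m}$ is the integral of $K^{\dagger m}$ against $\nu_{(x,z)}$ in the starting values of the $(x,y)$-coordinates. For probability measures $\mu,\nu$ on the same space, $\|\mu-\nu\|=\sup_{0\le f\le1}\big|\int f\,\mathrm{d}\mu-\int f\,\mathrm{d}\nu\big|$ over measurable $f$ (equivalently $\sup_A|\mu(A)-\nu(A)|$). *)

(* Defs.v *)
From HB Require Import structures.
From mathcomp Require Import all_boot all_order all_algebra.
From mathcomp Require Import all_classical all_reals all_analysis.
From mathcomp Require Import measurable_realfun.

Set Implicit Arguments.
Unset Strict Implicit.
Unset Printing Implicit Defensive.
Import Order.TTheory GRing.Theory Num.Theory.

Local Open Scope classical_set_scope.
Local Open Scope ring_scope.
Local Open Scope ereal_scope.

Definition countably_generated d (T : measurableType d) : Prop :=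
  exists2 C : set (set T), countable C & @measurable d T = <<s C >>.

Section coordinate_maps.
Context d d1 d2 (T : measurableType d) (T1 : measurableType d1)
  (T2 : measurableType d2).

HB.instance Definition _ :=
  isMeasurableFun.Build _ _ T T idfun (@measurable_id _ T [set: T]).
HB.instance Definition _ :=
  isMeasurableFun.Build _ _ (T1 * T2)%type T1 fst measurable_fst.
HB.instance Definition _ :=
  isMeasurableFun.Build _ _ (T1 * T2)%type T2 snd measurable_snd.

Definition fpair (f : {mfun T >-> T1}) (g : {mfun T >-> T2}) (t : T) :
  T1 * T2 := (f t, g t).

HB.instance Definition _ (f : {mfun T >-> T1}) (g : {mfun T >-> T2}) :=
  isMeasurableFun.Build _ _ T (T1 * T2)%type (fpair f g)
    (measurable_fun_pair (@measurable_funPT _ _ _ _ f)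
                         (@measurable_funPT _ _ _ _ g)).

End coordinate_maps.

Section total_variation.
Context d (T : measurableType d) (R : realType).

(* The supremum is over real-valued measurable f with values in [0, 1]; it is
   taken in \bar R, and is finite for probability measures. *)
Definition tv (mu nu : {measure set T -> \bar R}) : \bar R :=
  ereal_sup [set `| \int[mu]_x (f x)%:E - \int[nu]_x (f x)%:E |
    | f in [set f : T -> R | measurable_fun [set: T] f /\
                             forall x, (0 <= f x <= 1)%R]].

End total_variation.

(* k is a regular version of the conditional distribution of V given U. *)
Definition cond_distribution d d1 d2 (W : measurableType d)
    (T1 : measurableType d1) (T2 : measurableType d2) (R : realType)
    (P : probability W R) (U : {mfun W >-> T1}) (V : {mfun W >-> T2})
    (k : R.-pker T1 ~> T2) : Prop :=
  forall A B, measurable A -> measurable B ->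
    P (U @^-1` A `&` V @^-1` B) = \int[distribution P U]_(u in A) k u B.

Section kernel_reindexing.
Context d0 d1 d2 (T0 : measurableType d0) (T1 : measurableType d1)
  (T2 : measurableType d2) (R : realType).
Variables (k : R.-pker T1 ~> T2) (f : {mfun T0 >-> T1}).

(* The kernel (t, A) |-> k (f t) A. *)
Definition kcomap (t : T0) : {measure set T2 -> \bar R} := k (f t).

Let measurable_kcomap U : measurable U ->
  measurable_fun [set: T0] (kcomap ^~ U).
Proof.
move=> mU.
exact: (measurableT_comp (measurable_kernel k _ mU) (measurable_funPT f)).
Qed.

HB.instance Definition _ := isKernel.Build _ _ _ _ _ kcomap measurable_kcomap.

Let kcomap_prob t : kcomap t [set: T2] = 1.
Proof. exact: prob_kernel. Qed.

HB.instance Definition _ :=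
  Kernel_isProbability.Build _ _ _ _ _ kcomap kcomap_prob.

End kernel_reindexing.

Section kernel_product.
Context d0 d1 d2 (T0 : measurableType d0) (T1 : measurableType d1)
  (T2 : measurableType d2) (R : realType).
Variables (k1 : R.-pker T0 ~> T1) (k2 : R.-pker (T0 * T1) ~> T2).

(* The kernel t |-> k1(t, du) k2((t, u), dv) on T1 * T2. *)
Definition kprod (t : T0) : {measure set (T1 * T2) -> \bar R} :=
  mkproduct k1 k2 t.

Let measurable_kprod U : measurable U -> measurable_fun [set: T0] (kprod ^~ U).
Proof. exact: measurable_kproduct. Qed.

HB.instance Definition _ := isKernel.Build _ _ _ _ _ kprod measurable_kprod.

Let kprod_prob t : kprod t [set: T1 * T2] = 1.
Proof.
rewrite /kprod /mkproduct /= /kproduct (eq_integral (cst 1)) => [|u _].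
  by rewrite integral_cst// mul1e prob_kernel.
rewrite /kernel.intker_indic (eq_integral (cst 1)) => [|v _].
  by rewrite integral_cst// mul1e prob_kernel.
by rewrite indicT.
Qed.

HB.instance Definition _ :=
  Kernel_isProbability.Build _ _ _ _ _ kprod kprod_prob.

End kernel_product.

Section kernel_composition.
Context d0 d1 d2 (T0 : measurableType d0) (T1 : measurableType d1)
  (T2 : measurableType d2) (R : realType).
Variables (k1 : R.-pker T0 ~> T1) (k2 : R.-pker T1 ~> T2).

(* The kernel (t, A) |-> \int k1(t, du) k2(u, A). *)
Definition kseq (t : T0) : {measure set T2 -> \bar R} := mkcomp_noparam k1 k2 t.

Let measurable_kseq U : measurable U -> measurable_fun [set: T0] (kseq ^~ U).
Proof. exact: measurable_kernel. Qed.

HB.instance Definition _ := isKernel.Build _ _ _ _ _ kseq measurable_kseq.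

Let kseq_prob t : kseq t [set: T2] = 1.
Proof.
rewrite /kseq /mkcomp_noparam /= /kcomp_noparam.
rewrite (eq_integral (cst 1)) => [|u _]; last exact: prob_kernel.
by rewrite integral_cst// mul1e prob_kernel.
Qed.

HB.instance Definition _ :=
  Kernel_isProbability.Build _ _ _ _ _ kseq kseq_prob.

End kernel_composition.

Fixpoint kpow d (T : measurableType d) (R : realType) (P : R.-pker T ~> T)
    (n : nat) : R.-pker T ~> T :=
  if n is n'.+1 then kseq P (kpow P n') else kdirac (@measurable_id _ T [set: T]).

Section laws.
Context d0 d1 d2 (T0 : measurableType d0) (T1 : measurableType d1)
  (T2 : measurableType d2) (R : realType).

Definition klaw (k : R.-pker T0 ~> T1) (t : T0) : set T1 -> \bar R := k t.

HB.instance Definition _ (k : R.-pker T0 ~> T1) t := Measure.on (klaw k t).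
HB.instance Definition _ (k : R.-pker T0 ~> T1) t :=
  Measure_isProbability.Build _ _ _ (klaw k t) (prob_kernel t).

End laws.

Definition kconst d (T : measurableType d) (R : realType)
    (mu : probability T R) : R.-pker unit ~> T :=
  kprobability (measurable_cst (mu : pprobability T R)).

(* The law mu(du) k(u, dv) on T1 * T2. *)
Definition semidirect d1 d2 (T1 : measurableType d1) (T2 : measurableType d2)
    (R : realType) (mu : probability T1 R) (k : R.-pker T1 ~> T2) :
    probability (T1 * T2)%type R :=
  klaw (kprod (kconst mu) (kcomap k snd)) tt.

(* The law A |-> \int mu(du) k(u, A). *)
Definition mact d1 d2 (T1 : measurableType d1) (T2 : measurableType d2)
    (R : realType) (mu : probability T1 R) (k : R.-pker T1 ~> T2) :
    probability T2 R :=
  klaw (kseq (kconst mu) k) tt.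

Section markov_chains.
Context d (T : measurableType d) (R : realType) (P : R.-pker T ~> T).

Definition irreducibility_measure
    (phi : {sigma_finite_measure set T -> \bar R}) : Prop :=
  0 < phi [set: T] /\
  forall x A, measurable A -> 0 < phi A ->
    exists2 n : nat, (0 < n)%N & 0 < kpow P n x A.

Definition irreducible_chain : Prop :=
  exists phi : {sigma_finite_measure set T -> \bar R},
    irreducibility_measure phi.

(* For an irreducible chain the union of nonempty cyclic sets is absorbing,
   hence of full measure for every irreducibility measure. *)
Definition aperiodic_chain : Prop :=
  ~ exists (p : nat) (D : nat -> set T),
    [/\ (1 < p)%N,
        forall i, (i < p)%N -> measurable (D i) /\ D i !=set0,
        forall i j, (i < p)%N -> (j < p)%N -> i != j -> D i `&` D j = set0 &
        forall i x, (i < p)%N -> D i x -> P x (D (i.+1 %% p)%N) = 1].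

(* (Xi n)_n is, under Q, a Markov chain with kernel P started from x; events
   of the past are tested on the cylinders {Xi 0 \in A 0, ..., Xi n \in A n},
   which generate them. *)
Definition chain_from (x : T) dW (W : measurableType dW) (Q : probability W R)
    (Xi : nat -> {mfun W >-> T}) : Prop :=
  (forall A, measurable A -> Q (Xi 0%N @^-1` A) = \d_x A) /\
  forall (n : nat) (A : nat -> set T) (B : set T),
    (forall i, measurable (A i)) -> measurable B ->
    let past := \bigcap_(i in `I_n.+1) (Xi i @^-1` A i) in
    Q (past `&` Xi n.+1 @^-1` B) = \int[Q]_(w in past) P (Xi n w) B.

(* Every set charged by some (equivalently, by a maximal) irreducibility
   measure is visited infinitely often almost surely, from every starting point.
   The law of the trajectory is determined by x and P, and it exists by the
   Ionescu-Tulcea theorem, so quantifying over all realizations Xi of the chain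
   is the same as fixing one. *)
Definition harris_recurrent : Prop :=
  irreducible_chain /\
  forall phi, irreducibility_measure phi ->
  forall A, measurable A -> 0 < phi A ->
  forall x dW (W : measurableType dW) (Q : probability W R)
    (Xi : nat -> {mfun W >-> T}), chain_from x Q Xi ->
    Q (lim_sup_set (fun n => Xi n @^-1` A)) = 1.

Definition positive_chain : Prop :=
  exists pi : probability T R,
    forall A, measurable A -> mact pi P A = pi A.

Definition harris_ergodic : Prop :=
  [/\ irreducible_chain, aperiodic_chain, positive_chain & harris_recurrent].

End markov_chains.

Section gibbs.
Context dX dY dZ (X : measurableType dX) (Y : measurableType dY)
  (Z : measurableType dZ) (R : realType).
Variables (Pi : probability (X * Y * Z)%type R)
  (kX_Z : R.-pker Z ~> X) (kY_XZ : R.-pker (X * Z) ~> Y)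
  (kZ_XY : R.-pker (X * Y) ~> Z).

Definition conditional_versions : Prop :=
  [/\ cond_distribution Pi snd (fst \o fst) kX_Z,
      cond_distribution Pi (fpair (fst \o fst) snd) (snd \o fst) kY_XZ &
      cond_distribution Pi fst snd kZ_XY].

Definition kXY_Z : R.-pker Z ~> (X * Y)%type :=
  kprod kX_Z (kcomap kY_XZ (fpair snd fst)).

Definition block_gibbs : R.-pker (X * Y * Z) ~> (X * Y * Z)%type :=
  kprod (kcomap kXY_Z snd) (kcomap kZ_XY snd).

Definition block_gibbs_XY : R.-pker (X * Y) ~> (X * Y)%type := kseq kZ_XY kXY_Z.

Definition block_gibbs_Z : R.-pker Z ~> Z := kseq kXY_Z kZ_XY.

Definition reordered_gibbs : R.-pker (Z * (X * Y)) ~> (Z * (X * Y))%type :=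
  kprod (kcomap kZ_XY snd) (kcomap kXY_Z snd).

(* From s = (y, z, x): y' ~ kY_XZ (x, z), then z' ~ kZ_XY (x, y') read off
   (s, y'), then x' ~ kX_Z z' read off (s, (y', z')). *)
Definition out_of_order_gibbs : R.-pker (Y * Z * X) ~> (Y * Z * X)%type :=
  kprod
    (kprod (kcomap kY_XZ (fpair snd (snd \o fst)))
           (kcomap kZ_XY (fpair (snd \o fst) snd)))
    (kcomap kX_Z (snd \o snd)).

Definition Pi_XY : probability (X * Y)%type R := distribution Pi fst.

Definition Pi_Z : probability Z R := distribution Pi snd.

Definition Pi_ZXY : probability (Z * (X * Y))%type R :=
  distribution Pi (fpair snd fst).

(* Pi_{YZ}(dy, dz) Pi_{X|Z}(dx | z), in the coordinate order (y, z, x) of the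
   out-of-order chain. *)
Definition Pi_star : probability (Y * Z * X)%type R :=
  semidirect (distribution Pi (fpair (snd \o fst) snd)) (kcomap kX_Z snd).

Definition nu_Z (z : Z) : probability (X * Z)%type R :=
  distribution (semidirect (\d_z : probability Z R) kX_Z) (fpair snd fst).

Definition nu_XZ (x : X) (z : Z) : probability (X * Y)%type R :=
  semidirect (\d_x : probability X R) (kcomap kY_XZ (fpair idfun (cst z))).

(* The m-step kernel of the out-of-order chain as a function of the starting
   values (x, z), the starting value of y being fixed to y0; the choice of y0
   is immaterial for 0 < m. *)
Definition out_of_order_pow_XZ (y0 : Y) (m : nat) :
    R.-pker (X * Z) ~> (Y * Z * X)%type :=
  kcomap (kpow out_of_order_gibbs m) (fpair (fpair (cst y0) snd) fst).

Lemma out_of_order_pow_XZ_indep (y0 y1 : Y) (m : nat) (w : X * Z)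
    (A : set (Y * Z * X)) : (0 < m)%N ->
  out_of_order_pow_XZ y0 m w A = out_of_order_pow_XZ y1 m w A.
Proof. by case: m. Qed.

(* Same encoding, the starting value of z being fixed to z0. *)
Definition reordered_pow_XY (z0 : Z) (m : nat) :
    R.-pker (X * Y) ~> (Z * (X * Y))%type :=
  kcomap (kpow reordered_gibbs m) (fpair (cst z0) idfun).

Lemma reordered_pow_XY_indep (z0 z1 : Z) (m : nat) (w : X * Y)
    (A : set (Z * (X * Y))) : (0 < m)%N ->
  reordered_pow_XY z0 m w A = reordered_pow_XY z1 m w A.
Proof. by case: m. Qed.

End gibbs.

(* Main.v *)
Require Import Defs.
From HB Require Import structures.
From mathcomp Require Import all_boot all_order all_algebra.
From mathcomp Require Import all_classical all_reals all_analysis.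
From mathcomp Require Import measurable_realfun.

(* In each of the four inequalities the two laws on the left are the images of
   the two laws on the right under one Markov kernel, and applying a kernel does
   not increase total variation. The kernels are, in order: the block update
   (X, Y, Z | Z), which sends K_Z^(n-1) to K^n and Pi_Z to Pi; the first two
   updates of the out-of-order chain, which send nu_z K*^(n-2) to K_Z^(n-1) and
   Pi* to Pi_Z; the last two updates of the out-of-order chain, which send
   nu_(x,z) K_XY^(n-1) to K*^n and Pi_XY to Pi*; and the projection
   (z, x, y) |-> (x, y). *)

Set Implicit Arguments.
Unset Strict Implicit.
Unset Printing Implicit Defensive.
Import Order.TTheory GRing.Theory Num.Theory.

Local Open Scope classical_set_scope.
Local Open Scope ring_scope.
Local Open Scope ereal_scope.

(** * Nonnegative extended test functions, a class stable under kernel integration *)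

Definition nneg_mfun d (T : measurableType d) (R : realType)
    (f : T -> \bar R) : Prop :=
  measurable_fun [set: T] f /\ forall t, 0 <= f t.

Lemma nneg_mfun_comp d1 d2 (T1 : measurableType d1) (T2 : measurableType d2)
    (R : realType) (f : T2 -> \bar R) (g : {mfun T1 >-> T2}) :
  nneg_mfun f -> nneg_mfun (f \o g).
Proof.
by case=> mf f0; split=> [|t]; [exact: measurableT_comp | exact: f0].
Qed.

Lemma nneg_mfun_slice d1 d2 (T1 : measurableType d1) (T2 : measurableType d2)
    (R : realType) (f : T1 * T2 -> \bar R) t :
  nneg_mfun f -> nneg_mfun (fun u => f (t, u)).
Proof. by case=> mf f0; split=> //; exact: measurableT_comp. Qed.

Section nneg_mfun_integral.
Context d1 d2 (T1 : measurableType d1) (T2 : measurableType d2) (R : realType).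
Variable k : R.-pker T1 ~> T2.

Lemma nneg_mfun_integral_slice (f : T1 * T2 -> \bar R) :
  nneg_mfun f -> nneg_mfun (fun t => \int[k t]_u f (t, u)).
Proof.
case=> mf f0; split=> [|t]; last exact: integral_ge0.
exact: measurable_fun_integral_sfinite_kernel.
Qed.

Lemma nneg_mfun_integral (f : T2 -> \bar R) :
  nneg_mfun f -> nneg_mfun (fun t => \int[k t]_u f u).
Proof.
by move=> nf; exact: (nneg_mfun_integral_slice (nneg_mfun_comp snd nf)).
Qed.

End nneg_mfun_integral.

Lemma integral_kdirac d1 d2 (T1 : measurableType d1) (T2 : measurableType d2)
    (R : realType) (g : T1 -> T2) (mg : measurable_fun [set: T1] g)
    (f : T2 -> \bar R) t :
  nneg_mfun f -> \int[kdirac mg t]_u f u = f (g t).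
Proof. by case=> mf _; rewrite /kdirac integral_dirac// diracT mul1e. Qed.

(** * Iterated integrals against composed and product kernels *)

Section integral_composition.
Context (R : realType) d0 d1 d2 (T0 : measurableType d0)
  (T1 : measurableType d1) (T2 : measurableType d2).

Lemma integral_kseq (k1 : R.-pker T0 ~> T1) (k2 : R.-pker T1 ~> T2)
    (f : T2 -> \bar R) t :
  nneg_mfun f -> \int[kseq k1 k2 t]_v f v = \int[k1 t]_u \int[k2 u]_v f v.
Proof. by case=> mf f0; exact: (integral_kcomp k1 (kcomap k2 snd)). Qed.

(** The product kernel is the composition of [k1] with the kernel [l] that draws v from [k2] and
    returns (u, v), so the formula for compositions applies twice. *)
Lemma integral_kprod (k1 : R.-pker T0 ~> T1) (k2 : R.-pker (T0 * T1) ~> T2)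
    (f : T1 * T2 -> \bar R) t :
  nneg_mfun f ->
  \int[kprod k1 k2 t]_w f w = \int[k1 t]_u \int[k2 (t, u)]_v f (u, v).
Proof.
move=> nf; have [mf f0] := nf.
pose g : {mfun (T0 * T1 * T2)%type >-> (T1 * T2)%type} :=
  fpair (snd \o fst) snd.
pose l := mkcomp k2 (kdirac (measurable_funPT g)).
transitivity (\int[kcomp k1 l t]_w f w).
  exact: eq_measure_integral.
rewrite integral_kcomp//; apply: eq_integral => u _.
rewrite integral_kcomp//; apply: eq_integral => v _.
by rewrite integral_kdirac.
Qed.

End integral_composition.

(** * Images of laws under a kernel, and contraction of total variation *)

Section integral_laws.
Context (R : realType) d1 d2 (T1 : measurableType d1)
  (T2 : measurableType d2).

Lemma integral_mact (mu : probability T1 R) (k : R.-pker T1 ~> T2)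
    (f : T2 -> \bar R) :
  nneg_mfun f -> \int[mact mu k]_v f v = \int[mu]_u \int[k u]_v f v.
Proof. by move=> nf; exact: (integral_kseq (kconst mu)). Qed.

Lemma integral_semidirect (mu : probability T1 R) (k : R.-pker T1 ~> T2)
    (f : T1 * T2 -> \bar R) :
  nneg_mfun f ->
  \int[semidirect mu k]_w f w = \int[mu]_u \int[k u]_v f (u, v).
Proof. by move=> nf; exact: (integral_kprod (kconst mu) (kcomap k snd)). Qed.

Lemma integral_distribution (P : probability T1 R) (g : {mfun T1 >-> T2})
    (f : T2 -> \bar R) :
  nneg_mfun f -> \int[distribution P g]_v f v = \int[P]_u f (g u).
Proof. by case=> mf f0; exact: ge0_integral_distribution. Qed.

(** Integrating a test function f with values in [0, 1] against [k] gives a test function g of the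
    same kind, and f separates the images exactly as much as g separates [mu] and [nu]. Hence the
    left supremum runs over a subset of the right one. *)
Lemma tv_kernel_le (k : R.-pker T1 ~> T2)
    (mu nu : {measure set T1 -> \bar R})
    (mu' nu' : {measure set T2 -> \bar R}) :
  (forall f, nneg_mfun f -> \int[mu']_v f v = \int[mu]_u \int[k u]_v f v) ->
  (forall f, nneg_mfun f -> \int[nu']_v f v = \int[nu]_u \int[k u]_v f v) ->
  tv mu' nu' <= tv mu nu.
Proof.
move=> mu'E nu'E; apply: ge_ereal_sup => _ [f [mf f01] <-].
have nf : nneg_mfun (EFin \o f).
  split=> [|v]; first exact/measurable_EFinP.
  by rewrite lee_fin; case/andP: (f01 v).
have [mg g0] := nneg_mfun_integral k nf.
have g1 u : \int[k u]_v (f v)%:E <= 1.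
  have -> : 1 = \int[k u]_v (cst 1 v).
    by rewrite integral_cst// prob_kernel mule1.
  apply: ge0_le_integral => //; first by move=> v _; exact: nf.2.
    exact: nf.1.
  by move=> v _; rewrite lee_fin; case/andP: (f01 v).
(* [tv] tests real-valued functions; the bound by 1 makes [fine] lossless here. *)
pose g t := fine (\int[k t]_v (f v)%:E).
have gE t : (g t)%:E = \int[k t]_v (f v)%:E.
  by rewrite fineK// ge0_fin_numE// (le_lt_trans (g1 t))// ltry.
apply: ereal_sup_ubound; exists g.
  split=> [|t]; last by rewrite -!lee_fin gE g0 g1.
  by apply/measurable_EFinP; apply: eq_measurable_fun mg => t _; rewrite /= gE.
by rewrite mu'E// nu'E//; congr (`| _ - _ |); apply: eq_integral => t _.
Qed.

End integral_laws.

(** * Disintegration along a regular conditional distribution *)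

Section conditional_distribution.
Context d d1 d2 (W : measurableType d) (T1 : measurableType d1)
  (T2 : measurableType d2) (R : realType).
Variables (P : probability W R) (U : {mfun W >-> T1}) (V : {mfun W >-> T2})
  (k : R.-pker T1 ~> T2).
Hypothesis kE : cond_distribution P U V k.

(** [cond_distribution] speaks of rectangles only. They are stable under intersection and generate
    the product sigma-algebra, and both laws are finite, so agreement on rectangles suffices. *)
Lemma cond_distribution_semidirect A : measurable A ->
  distribution P (fpair U V) A = semidirect (distribution P U) k A.
Proof.
pose C : set (set (T1 * T2)) :=
  [set A `*` B | A in measurable & B in measurable].
apply: (measure_unique C (fun=> setT)).
- exact: measurable_prod_measurableType.
- move=> _ _ [A1 mA1 [B1 mB1 <-]] [A2 mA2 [B2 mB2 <-]]; rewrite -setXI.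
  exists (A1 `&` A2); first exact: measurableI.
  by exists (B1 `&` B2); first exact: measurableI.
- by move=> _; exists setT => //; exists setT => //; rewrite setXTT.
- by apply/seteqP; split=> // t _; exists 0%N.
- move=> _ [A1 mA [B mB <-]].
  rewrite [LHS](_ : _ = P (U @^-1` A1 `&` V @^-1` B))// kE//.
  rewrite -[A1 `*` B in RHS]setIT -integral_indic//;
    last exact: measurableX.
  rewrite integral_semidirect; last first.
    split=> [|w]; last by rewrite lee_fin.
    by apply/measurable_EFinP; apply: measurable_indic;
      exact: measurableX.
  rewrite integral_mkcond; apply: eq_integral => u _.
  rewrite patchE; case: ifPn => uA.
    rewrite -[B in LHS]setIT -integral_indic//; apply: eq_integral => v _.
    by rewrite !indicE in_setX/= uA.
  rewrite integral0_eq// => v _.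
  by rewrite indicE in_setX/= (negbTE uA).
- by move=> _; rewrite (le_lt_trans (probability_le1 _ _))// ltry.
Qed.

(** Both sides integrate over [P] itself, so that successive redraws of different coordinates can be
    chained without changing the base measure. *)
Lemma integral_cond_distribution (f : T1 * T2 -> \bar R) : nneg_mfun f ->
  \int[P]_w f (U w, V w) = \int[P]_w \int[k (U w)]_v f (U w, v).
Proof.
move=> nf; rewrite -(integral_distribution P (fpair U V))//.
rewrite (@eq_measure_integral _ _ _ _ (semidirect (distribution P U) k)).
  rewrite integral_semidirect// integral_distribution//.
  exact: nneg_mfun_integral_slice.
by move=> A mA _; exact: cond_distribution_semidirect.
Qed.

End conditional_distribution.

(** * Powers of the Gibbs chains, by regrouping their updates *)

Section gibbs_comparison.
Context dX dY dZ (X : measurableType dX) (Y : measurableType dY)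
  (Z : measurableType dZ) (R : realType).
Variables (Pi : probability (X * Y * Z)%type R)
  (kX_Z : R.-pker Z ~> X) (kY_XZ : R.-pker (X * Z) ~> Y)
  (kZ_XY : R.-pker (X * Y) ~> Z).
Local Notation K := (block_gibbs kX_Z kY_XZ kZ_XY).
Local Notation K_XY := (block_gibbs_XY kX_Z kY_XZ kZ_XY).
Local Notation K_Z := (block_gibbs_Z kX_Z kY_XZ kZ_XY).
Local Notation Kdag := (reordered_gibbs kX_Z kY_XZ kZ_XY).
Local Notation Kstar := (out_of_order_gibbs kX_Z kY_XZ kZ_XY).

Lemma integral_kXY_Z (f : X * Y -> \bar R) z : nneg_mfun f ->
  \int[kXY_Z kX_Z kY_XZ z]_w f w =
  \int[kX_Z z]_x \int[kY_XZ (x, z)]_y f (x, y).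
Proof. exact: integral_kprod. Qed.

(** A step of [K] with its starting values of x and y, which it ignores, removed. *)
Definition block_kernel : R.-pker Z ~> (X * Y * Z)%type :=
  kprod (kXY_Z kX_Z kY_XZ) (kcomap kZ_XY snd).

Lemma integral_block_kernel (f : X * Y * Z -> \bar R) z : nneg_mfun f ->
  \int[block_kernel z]_w f w =
  \int[kXY_Z kX_Z kY_XZ z]_u \int[kZ_XY u]_z' f (u, z').
Proof. exact: integral_kprod. Qed.

Lemma integral_block_gibbs (f : X * Y * Z -> \bar R) w : nneg_mfun f ->
  \int[K w]_w' f w' = \int[block_kernel w.2]_w' f w'.
Proof.
by move=> nf; rewrite integral_block_kernel//; exact: integral_kprod.
Qed.

(** Each step of [K] reads only z, and the z it produces follows [K_Z]. Thus the first m steps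
    matter only through [K_Z], and the last one produces the whole triple. *)
Lemma integral_block_gibbs_pow (f : X * Y * Z -> \bar R) m w : nneg_mfun f ->
  \int[kpow K m.+1 w]_w' f w' =
  \int[kpow K_Z m w.2]_z \int[block_kernel z]_w' f w'.
Proof.
move=> nf; have nBf := nneg_mfun_integral block_kernel nf.
elim: m w => [|m IH] w.
  rewrite integral_kseq// integral_kdirac//.
  under eq_integral do rewrite integral_kdirac//.
  by rewrite integral_block_gibbs.
rewrite integral_kseq//; under eq_integral do rewrite IH.
have nG := nneg_mfun_integral (kpow K_Z m) nBf.
rewrite integral_block_gibbs; last exact: (nneg_mfun_comp snd nG).
rewrite integral_block_kernel; last exact: (nneg_mfun_comp snd nG).
by rewrite /= integral_kseq// integral_kseq.
Qed.

(* The (Y, Z)-update of the out-of-order chain. *)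
Definition out_of_order_YZ : R.-pker (Y * Z * X) ~> (Y * Z)%type :=
  kprod (kcomap kY_XZ (fpair snd (snd \o fst)))
        (kcomap kZ_XY (fpair (snd \o fst) snd)).

Lemma integral_out_of_order_YZ (f : Y * Z -> \bar R) s : nneg_mfun f ->
  \int[out_of_order_YZ s]_w f w =
  \int[kY_XZ (s.2, s.1.2)]_y \int[kZ_XY (s.2, y)]_z f (y, z).
Proof. exact: integral_kprod. Qed.

Lemma integral_out_of_order_gibbs (f : Y * Z * X -> \bar R) s : nneg_mfun f ->
  \int[Kstar s]_w f w =
  \int[out_of_order_YZ s]_w \int[kX_Z w.2]_x f (w, x).
Proof. exact: integral_kprod. Qed.

(** [K_Z] updates X, Y, Z in this order, hence X and then (Y, Z); the value [y] is a placeholder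
    that the update never reads. *)
Lemma integral_block_gibbs_Z (f : Z -> \bar R) y z : nneg_mfun f ->
  \int[K_Z z]_z' f z' =
  \int[kX_Z z]_x \int[out_of_order_YZ (y, z, x)]_w f w.2.
Proof.
move=> nf; rewrite integral_kseq// integral_kXY_Z; last first.
  exact: nneg_mfun_integral.
apply: eq_integral => x _.
by rewrite integral_out_of_order_YZ//; exact: (nneg_mfun_comp snd nf).
Qed.

(** As words in the updates, (X Y Z)^(m+1) = X (Y Z X)^m Y Z. The induction keeps [y] and [z]
    general because the next round starts from the freshly drawn pair. *)
Lemma integral_block_gibbs_Z_pow (f : Z -> \bar R) m y z : nneg_mfun f ->
  \int[kpow K_Z m.+1 z]_z' f z' =
  \int[kX_Z z]_x \int[kpow Kstar m (y, z, x)]_s \int[out_of_order_YZ s]_w f w.2.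
Proof.
move=> nf.
have nf2 : nneg_mfun (fun w : Y * Z => f w.2) := nneg_mfun_comp snd nf.
have nYf := nneg_mfun_integral out_of_order_YZ nf2.
elim: m y z => [|m IH] y z.
  rewrite integral_kseq//.
  under eq_integral do rewrite integral_kdirac//.
  rewrite (integral_block_gibbs_Z y)//.
  by apply: eq_integral => x _; rewrite integral_kdirac.
rewrite integral_kseq// (integral_block_gibbs_Z y); last first.
  exact: nneg_mfun_integral.
apply: eq_integral => x _.
rewrite integral_kseq// integral_out_of_order_gibbs; last first.
  exact: nneg_mfun_integral.
by apply: eq_integral => -[y' z'] _; exact: IH.
Qed.

Lemma integral_nu_Z (f : X * Z -> \bar R) z : nneg_mfun f ->
  \int[nu_Z kX_Z z]_w f w = \int[kX_Z z]_x f (x, z).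
Proof.
move=> nf; rewrite integral_distribution// integral_semidirect; last first.
  exact: (nneg_mfun_comp (fpair snd fst) nf).
have nf' := nneg_mfun_comp (fpair snd fst) nf :
  nneg_mfun (fun w : Z * X => f (w.2, w.1)).
have [mg _] := nneg_mfun_integral_slice kX_Z nf'.
by rewrite integral_dirac// diracT mul1e.
Qed.

Lemma integral_nu_XZ (f : X * Y -> \bar R) x z : nneg_mfun f ->
  \int[nu_XZ kY_XZ x z]_w f w = \int[kY_XZ (x, z)]_y f (x, y).
Proof.
move=> nf; rewrite integral_semidirect//.
have [mg _] := nneg_mfun_integral_slice (kcomap kY_XZ (fpair idfun (cst z))) nf.
by rewrite integral_dirac// diracT mul1e.
Qed.

(* The law of (Y, Z', X') when Z' and then X' are updated from (X, Y). *)
Definition out_of_order_ZX : R.-pker (X * Y) ~> (Y * Z * X)%type :=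
  kprod (kprod (kdirac (@measurable_snd _ _ X Y)) (kcomap kZ_XY fst))
        (kcomap kX_Z (snd \o snd)).

Lemma integral_out_of_order_ZX (f : Y * Z * X -> \bar R) w : nneg_mfun f ->
  \int[out_of_order_ZX w]_s f s =
  \int[kZ_XY w]_z \int[kX_Z z]_x f (w.2, z, x).
Proof.
move=> nf; rewrite integral_kprod//.
have nG : nneg_mfun (fun p : Y * Z => \int[kX_Z p.2]_x f (p, x)).
  exact: (nneg_mfun_integral_slice (kcomap kX_Z snd) nf).
rewrite integral_kprod//.
rewrite integral_kdirac//.
have nG' := nneg_mfun_comp (fpair (snd \o fst) snd) nG :
  nneg_mfun (fun p : X * Y * Y * Z => \int[kX_Z p.2]_x f (p.1.2, p.2, x)).
exact: (nneg_mfun_slice w (nneg_mfun_integral_slice (kcomap kZ_XY fst) nG')).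
Qed.

Lemma integral_out_of_order_gibbs_ZX (f : Y * Z * X -> \bar R) s :
  nneg_mfun f ->
  \int[Kstar s]_w f w =
  \int[kY_XZ (s.2, s.1.2)]_y \int[out_of_order_ZX (s.2, y)]_w f w.
Proof.
move=> nf; rewrite integral_out_of_order_gibbs// integral_out_of_order_YZ.
  by apply: eq_integral => y _; rewrite integral_out_of_order_ZX.
exact: (nneg_mfun_integral_slice (kcomap kX_Z snd) nf).
Qed.

(** The regrouping is now (Y Z X)^(m+1) = Y (Z X Y)^m Z X, where Z X Y is one step of [K_XY]. *)
Lemma integral_out_of_order_gibbs_pow (f : Y * Z * X -> \bar R) m s :
  nneg_mfun f ->
  \int[kpow Kstar m.+1 s]_w f w =
  \int[kY_XZ (s.2, s.1.2)]_y
    \int[kpow K_XY m (s.2, y)]_w \int[out_of_order_ZX w]_s' f s'.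
Proof.
move=> nf; have nLf := nneg_mfun_integral out_of_order_ZX nf.
elim: m s => [|m IH] s.
  rewrite integral_kseq//; under eq_integral do rewrite integral_kdirac//.
  rewrite integral_out_of_order_gibbs_ZX//.
  by apply: eq_integral => y _; rewrite integral_kdirac.
rewrite integral_kseq//; under eq_integral do rewrite IH.
have nG := nneg_mfun_integral (kpow K_XY m) nLf.
(* Measurability in the starting state, needed to integrate the induction hypothesis over one more
   step of [Kstar]. *)
have nH : nneg_mfun (fun s : Y * Z * X => \int[kY_XZ (s.2, s.1.2)]_y
    \int[kpow K_XY m (s.2, y)]_w \int[out_of_order_ZX w]_s' f s').
  have nG' := nneg_mfun_comp (fpair (snd \o fst) snd) nG :
    nneg_mfun (fun p : Y * Z * X * Y => \int[kpow K_XY m (p.1.2, p.2)]_w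
      \int[out_of_order_ZX w]_s' f s').
  exact: (nneg_mfun_integral_slice (kcomap kY_XZ (fpair snd (snd \o fst))) nG').
rewrite integral_out_of_order_gibbs_ZX//; apply: eq_integral => y _.
rewrite integral_out_of_order_ZX//= integral_kseq// integral_kseq//.
by apply: eq_integral => z _; rewrite integral_kXY_Z.
Qed.

Lemma integral_reordered_gibbs_snd (f : X * Y -> \bar R) w : nneg_mfun f ->
  \int[Kdag w]_w' f w'.2 = \int[K_XY w.2]_u f u.
Proof.
move=> nf; rewrite integral_kprod ?integral_kseq//.
exact: (nneg_mfun_comp snd nf).
Qed.

(** Since a step of [Kdag] ignores z, its (x, y)-coordinates form a Markov chain on their own, with
    kernel [K_XY]. *)
Lemma integral_reordered_gibbs_pow_snd (f : X * Y -> \bar R) m w :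
  nneg_mfun f -> \int[kpow Kdag m w]_w' f w'.2 = \int[kpow K_XY m w.2]_u f u.
Proof.
move=> nf; have nf2 := nneg_mfun_comp snd nf :
  nneg_mfun (fun w : Z * (X * Y) => f w.2).
elim: m w => [|m IH] w; first by rewrite !integral_kdirac.
rewrite [LHS]integral_kseq// [RHS]integral_kseq//.
under eq_integral do rewrite IH.
exact: (integral_reordered_gibbs_snd w (nneg_mfun_integral (kpow K_XY m) nf)).
Qed.

(** * The target laws under redrawing of coordinates *)

Hypothesis Pi_versions : conditional_versions Pi kX_Z kY_XZ kZ_XY.

Lemma integral_Pi_X (f : Z * X -> \bar R) : nneg_mfun f ->
  \int[Pi]_w f (w.2, w.1.1) = \int[Pi]_w \int[kX_Z w.2]_x f (w.2, x).
Proof. by case: Pi_versions => h _ _;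
  exact: integral_cond_distribution h _. Qed.

Lemma integral_Pi_Y (f : X * Z * Y -> \bar R) : nneg_mfun f ->
  \int[Pi]_w f (w.1.1, w.2, w.1.2) =
  \int[Pi]_w \int[kY_XZ (w.1.1, w.2)]_y f (w.1.1, w.2, y).
Proof. by case: Pi_versions => _ h _;
  exact: integral_cond_distribution h _. Qed.

Lemma integral_Pi_Z (f : X * Y * Z -> \bar R) : nneg_mfun f ->
  \int[Pi]_w f w = \int[Pi]_w \int[kZ_XY w.1]_z f (w.1, z).
Proof.
case: Pi_versions => _ _ h nf; rewrite -(integral_cond_distribution h)//.
by apply: eq_integral => -[].
Qed.

(* Redrawing X given Z and then Y given (X, Z) leaves Pi unchanged. *)
Lemma integral_Pi_XY (f : X * Y -> \bar R) : nneg_mfun f ->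
  \int[Pi]_w \int[kX_Z w.2]_x \int[kY_XZ (x, w.2)]_y f (x, y) =
  \int[Pi]_w f w.1.
Proof.
move=> nf.
have nf' := nneg_mfun_comp (fpair (fst \o fst) snd) nf :
  nneg_mfun (fun p : X * Z * Y => f (p.1.1, p.2)).
have nG := nneg_mfun_comp (fpair snd fst) (nneg_mfun_integral_slice kY_XZ nf') :
  nneg_mfun (fun p : Z * X => \int[kY_XZ (p.2, p.1)]_y f (p.2, y)).
(* The redraw of X is undone first: only then is [kY_XZ] evaluated at the actual (X, Z), so that the
   redraw of Y can be undone too. *)
rewrite -(integral_Pi_X nG) -(integral_Pi_Y nf').
by apply: eq_integral => -[[]].
Qed.

(** Once Z is redrawn given (X, Y), the integrand depends on (X, Y) alone, and [integral_Pi_XY]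
    redraws that pair given the old Z. *)
Lemma integral_Pi_block_kernel (f : X * Y * Z -> \bar R) : nneg_mfun f ->
  \int[Pi]_w f w = \int[Pi_Z Pi]_z \int[block_kernel z]_w f w.
Proof.
move=> nf; rewrite integral_distribution; last exact: nneg_mfun_integral.
have nG := nneg_mfun_integral_slice kZ_XY nf.
rewrite integral_Pi_Z// -(integral_Pi_XY nG); apply: eq_integral => w _.
by rewrite integral_block_kernel// integral_kXY_Z.
Qed.

Lemma integral_Pi_star (f : Y * Z * X -> \bar R) : nneg_mfun f ->
  \int[Pi_star Pi kX_Z]_s f s =
  \int[Pi]_w \int[kX_Z w.2]_x f (w.1.2, w.2, x).
Proof.
move=> nf; rewrite integral_semidirect// integral_distribution//.
exact: (nneg_mfun_integral_slice (kcomap kX_Z snd) nf).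
Qed.

(** The update discards the old y, the only coordinate through which [Pi_star] differs from a
    redraw: x and the fresh y form the pair redrawn given Z, so they have law [Pi_XY], and the new z
    has law [Pi_Z]. *)
Lemma integral_Pi_star_YZ (f : Z -> \bar R) : nneg_mfun f ->
  \int[Pi_Z Pi]_z f z =
  \int[Pi_star Pi kX_Z]_s \int[out_of_order_YZ s]_w f w.2.
Proof.
move=> nf.
have nf2 : nneg_mfun (fun w : Y * Z => f w.2) := nneg_mfun_comp snd nf.
rewrite integral_distribution// integral_Pi_star; last first.
  exact: nneg_mfun_integral.
have nf3 := nneg_mfun_comp snd nf : nneg_mfun (fun w : X * Y * Z => f w.2).
rewrite (integral_Pi_Z nf3) -(integral_Pi_XY (nneg_mfun_integral kZ_XY nf)).
apply: eq_integral => w _; apply: eq_integral => x _.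
by rewrite integral_out_of_order_YZ.
Qed.

(** Redrawing Z given (X, Y) restores the joint law of (Y, Z); the draw of X from Z alone is then
    the one that defines [Pi_star]. *)
Lemma integral_Pi_star_ZX (f : Y * Z * X -> \bar R) : nneg_mfun f ->
  \int[Pi_star Pi kX_Z]_s f s =
  \int[Pi_XY Pi]_w \int[out_of_order_ZX w]_s f s.
Proof.
move=> nf; rewrite integral_Pi_star// integral_distribution; last first.
  exact: nneg_mfun_integral.
have nG : nneg_mfun (fun p : Y * Z => \int[kX_Z p.2]_x f (p, x)).
  exact: (nneg_mfun_integral_slice (kcomap kX_Z snd) nf).
have nG' := nneg_mfun_comp (fpair (snd \o fst) snd) nG :
  nneg_mfun (fun p : X * Y * Z => \int[kX_Z p.2]_x f (p.1.2, p.2, x)).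
rewrite (integral_Pi_Z nG').
by apply: eq_integral => w _; rewrite integral_out_of_order_ZX.
Qed.

(** * The four total variation comparisons *)

Lemma tv_block_gibbs_le m w :
  tv (kpow K m.+1 w) Pi <= tv (kpow K_Z m w.2) (Pi_Z Pi).
Proof.
apply: (tv_kernel_le (k := block_kernel)) => f nf.
  exact: integral_block_gibbs_pow.
exact: integral_Pi_block_kernel.
Qed.

(** The exponents differ by one because the leading X-update is absorbed into [nu_Z] and the
    trailing (Y, Z)-update into the contracting kernel. *)
Lemma tv_block_gibbs_Z_le m z y0 :
  tv (kpow K_Z m.+1 z) (Pi_Z Pi) <=
  tv (mact (nu_Z kX_Z z) (out_of_order_pow_XZ kX_Z kY_XZ kZ_XY y0 m))
     (Pi_star Pi kX_Z).
Proof.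
pose k := kseq out_of_order_YZ (kdirac (@measurable_snd _ _ Y Z)).
apply: (tv_kernel_le (k := k)) => f nf.
  have nf2 : nneg_mfun (fun w : Y * Z => f w.2) := nneg_mfun_comp snd nf.
  rewrite [RHS]integral_mact; last exact: nneg_mfun_integral.
  rewrite [RHS]integral_nu_Z; last first.
    exact/nneg_mfun_integral/nneg_mfun_integral.
  rewrite [LHS](integral_block_gibbs_Z_pow m y0 z nf).
  apply: eq_integral => x _; apply: eq_integral => s _; rewrite integral_kseq//.
  by apply: eq_integral => w _; rewrite integral_kdirac.
rewrite integral_Pi_star_YZ//; apply: eq_integral => s _.
by rewrite integral_kseq//; apply: eq_integral => w _; rewrite integral_kdirac.
Qed.

Lemma tv_out_of_order_gibbs_le m s :
  tv (kpow Kstar m.+1 s) (Pi_star Pi kX_Z) <=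
  tv (mact (nu_XZ kY_XZ s.2 s.1.2) (kpow K_XY m)) (Pi_XY Pi).
Proof.
apply: (tv_kernel_le (k := out_of_order_ZX)) => f nf; last first.
  exact: integral_Pi_star_ZX.
have nLf := nneg_mfun_integral out_of_order_ZX nf.
rewrite [RHS]integral_mact// [RHS]integral_nu_XZ; last first.
  exact: nneg_mfun_integral.
exact: integral_out_of_order_gibbs_pow.
Qed.

Lemma tv_block_gibbs_XY_le (nu : probability (X * Y)%type R) m z0 :
  tv (mact nu (kpow K_XY m)) (Pi_XY Pi) <=
  tv (mact nu (reordered_pow_XY kX_Z kY_XZ kZ_XY z0 m)) (Pi_ZXY Pi).
Proof.
apply: (tv_kernel_le (k := kdirac (@measurable_snd _ _ Z (X * Y)%type)))
  => f nf.
  rewrite [LHS]integral_mact// [RHS]integral_mact; last first.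
    exact: nneg_mfun_integral.
  apply: eq_integral => u _.
  rewrite -(integral_reordered_gibbs_pow_snd m (z0, u))//.
  by apply: eq_integral => w _; rewrite integral_kdirac.
rewrite !integral_distribution//; last exact: nneg_mfun_integral.
by apply: eq_integral => w _; rewrite integral_kdirac.
Qed.

End gibbs_comparison.

Theorem proposition3 (R : realType) (dX dY dZ : measure_display)
    (X : measurableType dX) (Y : measurableType dY) (Z : measurableType dZ)
    (Pi : probability (X * Y * Z)%type R)
    (kX_Z : R.-pker Z ~> X) (kY_XZ : R.-pker (X * Z) ~> Y)
    (kZ_XY : R.-pker (X * Y) ~> Z) :
  countably_generated X -> countably_generated Y -> countably_generated Z ->
  conditional_versions Pi kX_Z kY_XZ kZ_XY ->
  let K := block_gibbs kX_Z kY_XZ kZ_XY in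
  let K_XY := block_gibbs_XY kX_Z kY_XZ kZ_XY in
  let K_Z := block_gibbs_Z kX_Z kY_XZ kZ_XY in
  let Kdag := reordered_gibbs kX_Z kY_XZ kZ_XY in
  let Kstar := out_of_order_gibbs kX_Z kY_XZ kZ_XY in
  harris_ergodic K -> harris_ergodic K_XY -> harris_ergodic K_Z ->
  harris_ergodic Kdag -> harris_ergodic Kstar ->
  (forall (z : Z) (x : X) (y : Y) (n : nat), (3 <= n)%N ->
     tv (kpow K n (x, y, z)) Pi <= tv (kpow K_Z n.-1 z) (Pi_Z Pi) /\
     forall y0 : Y,
       tv (kpow K_Z n.-1 z) (Pi_Z Pi) <=
       tv (mact (nu_Z kX_Z z)
                (out_of_order_pow_XZ kX_Z kY_XZ kZ_XY y0 (n - 2)%N))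
          (Pi_star Pi kX_Z)) /\
  (forall (x : X) (z : Z) (y : Y) (n : nat), (2 <= n)%N ->
     tv (kpow Kstar n (y, z, x)) (Pi_star Pi kX_Z) <=
     tv (mact (nu_XZ kY_XZ x z) (kpow K_XY n.-1)) (Pi_XY Pi) /\
     forall z0 : Z,
       tv (mact (nu_XZ kY_XZ x z) (kpow K_XY n.-1)) (Pi_XY Pi) <=
       tv (mact (nu_XZ kY_XZ x z)
                (reordered_pow_XY kX_Z kY_XZ kZ_XY z0 n.-1))
          (Pi_ZXY Pi)).
Proof.
move=> _ _ _ Pi_versions K K_XY K_Z Kdag Kstar _ _ _ _ _; split.
  (* With n = m+3 the exponents are m+3 for [K], m+2 for [K_Z] and m+1 for [Kstar]. *)
  move=> z x y [|[|[|m]]]// _; split; first exact: tv_block_gibbs_le.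
  by move=> y0; rewrite subn2; exact: tv_block_gibbs_Z_le.
move=> x z y [|[|m]]// _; split; first exact: tv_out_of_order_gibbs_le.
by move=> z0; exact: tv_block_gibbs_XY_le.
Qed.
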